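(* Let $\mathcal{S}$ be a primitive recognizable constant-length substitution on a finite alphabet $\mathcal{A}$ with expansion factor $K$, and let $\mathfrak{F}$ be a canonical infinite interval exchange transformation of $\mathcal{S}$. Then for a.e. $x\in[0,1]$ the sequence $\left(\mathfrak{F}^{K^n}(x)\right)_{n=1}^\infty$ has at most $|\mathcal{A}|$ accumulation points.
   Context: A substitution has constant length if there is $K\in\{2,3,\dots\}$ with $|\mathcal{S}(\alpha)|=K$ for all $\alpha\in\mathcal{A}$; then the expansion factor (the Perron–Frobenius eigenvalue $\lambda$ below) equals $K$. A substitution is primitive if some power of its substitution matrix has all entries positive. $\mathfrak{F}^{j}$ denotes the $j$-th iterate of $\mathfrak{F}$, defined almost everywhere. **Substitutions.** A substitution $\mathcal{S}$ on a finite alphabet $\mathcal{A}$ assigns to each $\alpha\in\mathcal{A}$ a nonempty finite word $\mathcal{S}(\alpha)=\mathcal{S}(\alpha)(0)\,\mathcal{S}(\alpha)(1)\cdots\mathcal{S}(\alpha)(|\mathcal{S}(\alpha)|-1)$ over $\mathcal{A}$; it extends to words by concatenation, which defines $\mathcal{S}^n(\alpha)$. Let $\mathcal{L}$ be the set of all subwords of all words $\mathcal{S}^n(\alpha)$, and let $\Sigma\subset\mathcal{A}^{\mathbb{Z}}$ (product topology) be the set of bi-infinite sequences all of whose finite subwords lie in $\mathcal{L}$. The shift is $(\sigma(\tau))(k)=\tau(k+1)$. For $\tau\in\Sigma$, $\mathcal{S}(\tau)=\cdots\mathcal{S}(\tau(-1))\mathcal{S}(\tau(0))\mathcal{S}(\tau(1))\cdots$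 with $\mathcal{S}(\tau(0))$ starting at coordinate $0$. $\mathcal{S}$ is recognizable if for every $\tau\in\Sigma$ there are a unique $\tau'\in\Sigma$ and $0\le k\le|\mathcal{S}(\tau'(0))|-1$ with $\tau=\sigma^k(\mathcal{S}(\tau'))$. Write $[\alpha]=\{\tau\in\Sigma:\tau(0)=\alpha\}$. The substitution matrix $M$ has entry $M_{\alpha\beta}$ equal to the number of occurrences of $\alpha$ in $\mathcal{S}(\beta)$; $\lambda$ is its Perron–Frobenius eigenvalue. **Measure.** $\mu$ is the $\sigma$-invariant Borel probability measure on $\Sigma$ (unique since $\mathcal{S}$ is primitive); it satisfies $\mu([\alpha])>0$ and $\mu(\mathcal{S}^n([\alpha]))=\mu([\alpha])/\lambda^n$ for all $\alpha\in\mathcal{A}$, $n\ge0$. **Addresses.** Let $\mathsf{A}=\{(\alpha,j):\alpha\in\mathcal{A},\ 0\le j\le|\mathcal{S}(\alpha)|-1\}$ and, for $\alpha\in\mathcal{A}$, $\mathsf{T}(\alpha)=\{(\beta,j)\in\mathsf{A}:\mathcal{S}(\beta)(j)=\alpha\}$. An address is a finite or infinite sequence $((\alpha_1,j_1),(\alpha_2,j_2),\dots)$ in $\mathsf{A}$ with $(\alpha_k,j_k)\in\mathsf{T}(\alpha_{k-1})$ for all $k>1$; $\mathbf{A}_n$ is the set of addresses of length $n$. **Partitions of $[0,1)$.** Choose $\Phi_0:\mathcal{A}\to[0,1)$ so that the intervals $[\Phi_0(\alpha),\Phi_0(\alpha)+\mu([\alpha]))$, $\alpha\in\mathcal{A}$,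 partition $[0,1)$. For each $\alpha\in\mathcal{A}$ choose an ordering of $\mathsf{T}(\alpha)$ and let $\phi:\mathsf{T}(\alpha)\to[0,\mu([\alpha]))$ give the left endpoints of the partition, in that order, of $[0,\mu([\alpha]))$ into intervals $[\phi(\beta,j),\phi(\beta,j)+\mu([\beta])/\lambda)$, $(\beta,j)\in\mathsf{T}(\alpha)$. (Since the sets $\mathsf{T}(\alpha)$ partition $\mathsf{A}$, this defines $\phi$ on $\mathsf{A}$. The orderings are recorded by a dual substitution $\mathcal{S}_*$, where $\mathcal{S}_*(\alpha)$ lists the letters $\beta$ of the elements $(\beta,j)\in\mathsf{T}(\alpha)$ in order.) For $\mathbf{a}=((\alpha_1,j_1),\dots,(\alpha_n,j_n))\in\mathbf{A}_n$ put $$\Phi_n(\mathbf{a})=\Phi_0(\mathcal{S}(\alpha_1)(j_1))+\sum_{k=1}^n\frac{\phi(\alpha_k,j_k)}{\lambda^{k-1}},\qquad \mathbf{I}(\mathbf{a})=\Big[\Phi_n(\mathbf{a}),\Phi_n(\mathbf{a})+\frac{\mu([\alpha_n])}{\lambda^n}\Big).$$ For each $n$ the intervals $\mathbf{I}(\mathbf{a})$, $\mathbf{a}\in\mathbf{A}_n$, partition $[0,1)$, and these partitions are successively refining. **The map $\mathfrak{F}$.** For an address $\mathbf{a}=((\alpha_k,j_k))_k$ let $\mathbf{n}(\mathbf{a})$ be the smallest $k$ with $j_k<|\mathcal{S}(\alpha_k)|-1$ ($\infty$ if there is none). If $\mathbf{n}(\mathbf{a})=N<\infty$, define $\mathcal{V}(\mathbf{a})$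 by replacing $(\alpha_N,j_N)$ with $(\alpha_N,j_N+1)$, replacing the first $N-1$ entries by the unique address $((\beta_1,0),\dots,(\beta_{N-1},0))$ with $\beta_{N-1}=\mathcal{S}(\alpha_N)(j_N+1)$ and $\beta_{k-1}=\mathcal{S}(\beta_k)(0)$, and leaving all entries of index $>N$ unchanged. For $x\in[0,1)$ let $\mathbf{a}(x)$ be the infinite address whose length-$n$ prefix $\mathbf{a}_n(x)$ is, for each $n$, the unique element of $\mathbf{A}_n$ with $x\in\mathbf{I}(\mathbf{a}_n(x))$, and let $\mathbf{n}(x)=\mathbf{n}(\mathbf{a}(x))$. For $x$ with $\mathbf{n}(x)=N<\infty$ (which holds for a.e. $x$) the infinite interval exchange transformation is $$\mathfrak{F}(x)=x-\Phi_N(\mathbf{a}_N(x))+\Phi_N(\mathcal{V}(\mathbf{a}_N(x))).$$ A canonical infinite interval exchange transformation of $\mathcal{S}$ is the map $\mathfrak{F}$ arising from any choice of $\Phi_0$ and of the orderings of the sets $\mathsf{T}(\alpha)$. *)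

(* Defs.v *)
From HB Require Import structures.
From mathcomp Require Import all_boot all_order all_algebra.
From mathcomp Require Import complex.
From mathcomp Require Import all_classical all_reals all_analysis.

Set Implicit Arguments.
Unset Strict Implicit.
Unset Printing Implicit Defensive.

Import Order.TTheory GRing.Theory Num.Theory.
Import numFieldNormedType.Exports.

Local Open Scope classical_set_scope.
Local Open Scope ring_scope.

Record substitution (A : finType) := Substitution {
  subst_word :> A -> seq A;
  subst_word_neq_nil : forall a, subst_word a != [::] }.

Section Substitutions.
Context {A : finType} (S : substitution A).

(* S(a)(j); the value is meaningful only when j < size (S a) *)
Definition subst_letter (a : A) (j : nat) : A := nth a (S a) j.

Definition subst_ext (w : seq A) : seq A := flatten (map S w).

Definition subst_iter (n : nat) (a : A) : seq A := iter n subst_ext [:: a].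

Definition language : set (seq A) :=
  [set w | exists n a, infix w (subst_iter n a)].

Definition subst_space : set (int -> A) :=
  [set t | forall (k : int) (n : nat),
    language [seq t (k + i%:Z) | i <- iota 0 n]].

Definition bishift (t : int -> A) : int -> A := fun k => t (k + 1).

(* The nonnegative coordinates of S(t) spell S(t(0)) S(t(1)) ..., and the
   coordinates -1, -2, ... spell the reversals of S(t(-1)), S(t(-2)), ...;
   as the words are nonempty, n.+1 of them determine the n-th letter.
   Note that Negz n is -(n+1). *)
Definition subst_biseq (t : int -> A) : int -> A := fun k =>
  match k with
  | Posz n => nth (t 0) (flatten [seq S (t (Posz i)) | i <- iota 0 n.+1]) n
  | Negz n =>
      nth (t 0) (flatten [seq rev (S (t (Negz i))) | i <- iota 0 n.+1]) n
  end.

Definition recognizable : Prop :=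
  forall t, subst_space t ->
    exists! p : (int -> A) * nat,
      [/\ subst_space p.1, (p.2 < size (S (p.1 0%R)))%N
        & t = iter p.2 bishift (subst_biseq p.1)].

Definition constant_length (K : nat) : Prop :=
  (2 <= K)%N /\ forall a, size (S a) = K.

(* rows and columns are indexed by A through its enumeration *)
Definition substitution_matrix (F : pzSemiRingType) : 'M[F]_#|A| :=
  \matrix_(i, j) (count_mem (enum_val i) (S (enum_val j)))%:R.

Definition primitive : Prop :=
  exists2 n : nat, (0 < n)%N &
    forall i j, 0 < (substitution_matrix int ^+ n) i j.

Definition perron_frobenius_eigenvalue (R : realType) (lam : R) : Prop :=
  eigenvalue (substitution_matrix R[i]) lam%:C%C /\
  forall z : R[i],
    eigenvalue (substitution_matrix R[i]) z -> `|z| <= lam%:C%C.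

End Substitutions.

(* The Borel sigma-algebra of the product topology on A^Z.  Measurable types
   are pointed, hence the letter a0, which plays no other role. *)
Definition biseq (A : finType) (a0 : A) : Type :=
  {ptws int -> discrete_topology A}.

HB.instance Definition _ (A : finType) (a0 : A) :=
  Topological.copy (biseq a0) {ptws int -> discrete_topology A}.
HB.instance Definition _ (A : finType) (a0 : A) :=
  isPointed.Build (biseq a0) (fun=> a0).

Definition biseq_open (A : finType) (a0 : A) : set (set (biseq a0)) :=
  open : set (set (biseq a0)).

Notation borel_biseq a0 := (g_sigma_algebraType (@biseq_open _ a0)).

(* A shift-invariant Borel probability measure on the closed set
   [subst_space S], seen as a measure on A^Z that gives it full mass. *)
Definition invariant_probability (R : realType) (A : finType)
    (S : substitution A) (a0 : A) (mu : probability (borel_biseq a0) R) : Prop :=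
  mu (subst_space S : set (borel_biseq a0)) = 1%E /\
  forall E : set (borel_biseq a0), measurable E ->
    mu ((@bishift A : borel_biseq a0 -> borel_biseq a0) @^-1` E) = mu E.

Definition letter_mass (R : realType) (A : finType) (S : substitution A)
    (a0 : A) (mu : probability (borel_biseq a0) R) (a : A) : R :=
  fine (mu ([set t | subst_space S t /\ t 0 = a] : set (borel_biseq a0))).

Section Addresses.
Context {A : finType} (S : substitution A).

Definition incoming (a : A) : pred (A * nat) :=
  [pred p | (p.2 < size (S p.1))%N && (subst_letter S p.1 p.2 == a)].

(* Entries are numbered from 0: the k-th entry is a k.-1. *)
Definition infinite_address (a : nat -> A * nat) : Prop :=
  (forall k, ((a k).2 < size (S (a k).1))%N) /\
  (forall k, a k.+1 \in incoming (a k).1).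

Definition non_final (p : A * nat) : bool := (p.2 < (size (S p.1)).-1)%N.

(* the unique address of length n with all positions 0 and last letter a *)
Fixpoint zero_address (n : nat) (a : A) : seq (A * nat) :=
  if n is m.+1 then rcons (zero_address m (subst_letter S a 0)) (a, 0%N)
  else [::].

(* Junk value: s itself when all its entries are final. *)
Definition vershik (s : seq (A * nat)) : seq (A * nat) :=
  let m := find non_final s in
  if drop m s is (a, j) :: s' then
    zero_address m (subst_letter S a j.+1) ++ (a, j.+1) :: s'
  else s.

End Addresses.

Section IntervalExchange.
Context {R : realType} {A : finType} (S : substitution A).
(* w a = mu [a], lam is the expansion factor, and ordT a lists T(a) in the
   chosen order. *)
Context (w : A -> R) (lam : R) (Phi0 : A -> R) (ordT : A -> seq (A * nat)).

Definition left_endpoints_spec : Prop :=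
  partition [set: A] (fun a => `[Phi0 a, Phi0 a + w a[%classic) `[0, 1[%classic.

Definition orderings_spec : Prop :=
  forall a, uniq (ordT a) /\ ordT a =i incoming S a.

Definition phi (p : A * nat) : R :=
  let s := ordT (subst_letter S p.1 p.2) in
  \sum_(q <- take (index p s) s) w q.1 / lam.

Definition Phi (s : seq (A * nat)) : R :=
  if s is p :: _ then
    Phi0 (subst_letter S p.1 p.2)
      + \sum_(k < size s) phi (nth p s k) / lam ^+ k
  else 0.

Definition address_interval (s : seq (A * nat)) : set R :=
  if s is p :: s' then
    `[Phi s, Phi s + w (last p s').1 / lam ^+ size s[%classic
  else `[0, 1[%classic.

Definition address_of (x : R) : option (nat -> A * nat) :=
  xget None [set Some a | a in [set a | infinite_address S a /\
    forall n, address_interval (mkseq a n) x]].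

(* The partially defined map; [None] outside its domain. *)
Definition iiet (x : R) : option R :=
  if address_of x is Some a then
    if pselect (exists k, non_final S (a k)) is left ex then
      let N := (ex_minn ex).+1 in
      Some (x - Phi (mkseq a N) + Phi (vershik S (mkseq a N)))
    else None
  else None.

End IntervalExchange.

Definition canonical_iiet (R : realType) (A : finType) (S : substitution A)
    (F : R -> option R) : Prop :=
  exists (a0 : A) (mu : probability (borel_biseq a0) R) (lam : R)
         (Phi0 : A -> R) (ordT : A -> seq (A * nat)),
    [/\ invariant_probability S mu,
        perron_frobenius_eigenvalue S lam,
        left_endpoints_spec (letter_mass S mu) Phi0,
        orderings_spec S ordT
      & F = iiet S (letter_mass S mu) lam Phi0 ordT].

Definition iter_partial (T : Type) (f : T -> option T) (j : nat) (x : T)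
    : option T :=
  iter j (obind f) (Some x).

(* Main.v *)
Require Import Defs.
From mathcomp Require Import all_boot all_order all_algebra.
From mathcomp Require Import complex.
From mathcomp Require Import all_classical all_reals all_analysis.
From mathcomp Require Import lra zify.

(** The address of a point is read as a base-K integer whose digits are the
positions j_1, j_2, ..., the first one least significant.  The Vershik map
resets the leading maximal digits to 0 and increments the next digit, so on
digits it is the addition of 1 ([address_val_successor]), and K^n steps give
back the first n digits ([iter_iiet_prefix]).  The letters may change, but the
letter read at level m determines, together with the digits below m, the whole
prefix of length m ([address_eq_prefix]).  Hence, for fixed m, all the points
F^(K^n)(x) with n >= m lie in at most #|A| intervals of length at most K^-m.
As m is arbitrary, a pigeonhole argument ([card_le_small_fibers]) bounds the
number of accumulation points by #|A|.

The orbit of x breaks off only if all digits of the address of x are maximal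
from some index on.  The same pigeonhole argument shows that, for a given
index, finitely many points are of this kind, so the exceptional set is
countable ([eventually_final_countable]).

All this supposes that every x in [0, 1) has one address, that is, that the
intervals of level n + 1 subdivide those of level n.  This amounts to two
facts.  The eigenvalue lambda equals K, as the all-ones row is a positive left
eigenvector ([perron_frobenius_constant_length]).  The letter masses m form a
right eigenvector: m(a) is the sum of m(b) / K over the occurrences of a in
the words S(b) ([letter_mass_incoming]).  For the latter, let Q f (b) be the
mean of f along S(b); the claim is that f and Q f have the same integral.  By
invariance, the integral of h = f - Q f is the mean of its averages along the
words of length L of the language.  Such a word is, up to two partial blocks,
a concatenation of words S^n(b), along which the average of h is
Q^n f (b) - Q^(n+1) f (b).  That is at most the oscillation of Q^n f, which
tends to 0 because primitivity makes a power of Q contract oscillations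
([letter_avg_contraction]).  Letting L and then n grow gives the claim. *)

Set Implicit Arguments.
Unset Strict Implicit.
Unset Printing Implicit Defensive.

Import Order.TTheory GRing.Theory Num.Theory.
Import numFieldNormedType.Exports.

Local Open Scope classical_set_scope.
Local Open Scope ring_scope.

(** * Iterated substitutions and their matrices *)
Section Words.
Context {A : finType} (S : substitution A).

Lemma subst_ext_cat u v :
  subst_ext S (u ++ v) = subst_ext S u ++ subst_ext S v.
Proof. by rewrite /subst_ext map_cat flatten_cat. Qed.

Lemma iter_subst_ext_cat n u v :
  iter n (subst_ext S) (u ++ v)
    = iter n (subst_ext S) u ++ iter n (subst_ext S) v.
Proof. by elim: n => //= n ->; rewrite subst_ext_cat. Qed.

Lemma iter_subst_ext_nil n : iter n (subst_ext S) [::] = [::].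
Proof. by elim: n => //= n ->. Qed.

Lemma iter_subst_ext_cons n b v :
  iter n (subst_ext S) (b :: v) = subst_iter S n b ++ iter n (subst_ext S) v.
Proof. by rewrite -cat1s iter_subst_ext_cat. Qed.

Lemma sum_iter_subst_ext (V : zmodType) n (f : A -> V) w :
  \sum_(c <- iter n (subst_ext S) w) f c
    = \sum_(b <- w) \sum_(c <- subst_iter S n b) f c.
Proof.
elim: w => [|b w IH]; first by rewrite iter_subst_ext_nil !big_nil.
by rewrite iter_subst_ext_cons big_cat big_cons /= IH.
Qed.

Context (K : nat) (len : constant_length S K).

Let sizeK a : size (S a) = K. Proof. by case: len. Qed.

Lemma size_subst_ext w : size (subst_ext S w) = (K * size w)%N.
Proof.
rewrite /subst_ext size_flatten /shape -map_comp.
elim: w => [|b w IH] /=; first by rewrite muln0.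
by rewrite IH sizeK mulnS.
Qed.

Lemma size_subst_iter n a : size (subst_iter S n a) = (K ^ n)%N.
Proof.
rewrite /subst_iter; elim: n => [|n IH] //=.
by rewrite size_subst_ext IH expnS.
Qed.

Lemma count_subst_ext x w :
  count_mem x (subst_ext S w)
    = (\sum_(b in A) count_mem x (S b) * count_mem b w)%N.
Proof.
elim: w => [|c w IH] /=; first by rewrite big1 // => b _; rewrite muln0.
rewrite /subst_ext /= count_cat -/(subst_ext S w) IH.
under [RHS]eq_bigr do rewrite mulnDr.
rewrite big_split /=; congr addn.
rewrite (bigD1 c) //= eqxx muln1 big1 ?addn0 // => b /negPf.
by rewrite eq_sym => ->; rewrite muln0.
Qed.

(** The entries of the powers of the matrix count letters in iterated words:
this turns primitivity into a statement on words. *)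
Lemma substitution_matrixX n (i j : 'I_#|A|) :
  (substitution_matrix S int ^+ n) i j
    = (count_mem (enum_val i) (subst_iter S n (enum_val j)))%:R.
Proof.
elim: n i j => [|n IH] i j.
  rewrite expr0 mxE /= addn0 (inj_eq enum_val_inj) eq_sym.
  by case: (i == j).
rewrite exprS mxE /= -/(subst_iter S n (enum_val j)) count_subst_ext.
rewrite natr_sum [RHS]big_enum_val; apply: eq_bigr => k _.
by rewrite IH mxE natrM.
Qed.

Lemma primitive_mem_subst_iter (prim : primitive S) :
  exists2 n : nat, (0 < n)%N & forall a c, c \in subst_iter S n a.
Proof.
have [n n0 pos] := prim; exists n => // a c.
have := pos (enum_rank c) (enum_rank a).
by rewrite substitution_matrixX !enum_rankK ltr0n -has_count has_pred1.
Qed.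

End Words.

(** * Averages along substituted words *)
Section Averages.
Context {R : realFieldType} {A : finType} (S : substitution A).
Context (K : nat) (len : constant_length S K).

Definition letter_avg (f : A -> R) (b : A) : R := (\sum_(c <- S b) f c) / K%:R.

Let sizeK a : size (S a) = K. Proof. by case: len. Qed.
Let K0 : (0 < K)%N. Proof. by case: len => /ltnW. Qed.
Let KR0 : (0 : R) < K%:R. Proof. by rewrite ltr0n. Qed.

(** All words have length K, so iterated means along S are plain means along
the words of S^n; this is where constant length enters. *)
Lemma sum_letter_avg n f b :
  \sum_(c <- subst_iter S n b) f c = (K ^ n)%:R * iter n letter_avg f b.
Proof.
elim: n f b => [|n IH] f b; first by rewrite /= big_seq1 expn0 mul1r.
have E : subst_ext S [:: b] = S b by rewrite /subst_ext /= cats0.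
rewrite /subst_iter iterSr E sum_iter_subst_ext.
under eq_bigr do rewrite IH.
rewrite -mulr_sumr /letter_avg expnSr natrM -mulrA; congr (_ * _).
by rewrite mulrC divfK // gt_eqF.
Qed.

Lemma iter_letter_avgB n f g b :
  iter n letter_avg (fun c => f c - g c) b
    = iter n letter_avg f b - iter n letter_avg g b.
Proof.
elim: n b => //= n IH b; rewrite /letter_avg.
by under eq_bigr do rewrite IH; rewrite sumrB mulrBl.
Qed.

Lemma sum_oscillation_le (s t : seq A) (f : A -> R) d :
  (forall a b, `|f a - f b| <= d) -> size s = size t ->
  `|\sum_(c <- s) f c - \sum_(c <- t) f c| <= (size s)%:R * d.
Proof.
move=> fd; elim: s t => [|x s IH] [|y t] //= => [_|[st]].
  by rewrite !big_nil subrr normr0 mul0r.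
rewrite !big_cons opprD addrACA (le_trans (ler_normD _ _)) //.
by rewrite mulrS mulrDl mul1r lerD // IH.
Qed.

(** Doeblin's argument: two words of length K^n that share a letter can be
matched so that one of the K^n pairs contributes nothing to the difference of
the sums. *)
Lemma letter_avg_contraction n f d :
  (forall a c, c \in subst_iter S n a) ->
  (forall a b, `|f a - f b| <= d) ->
  forall a b, `|iter n letter_avg f a - iter n letter_avg f b|
    <= (1 - (K ^ n)%:R^-1) * d.
Proof.
move=> full fd a b.
have Kn : (0 : R) < (K ^ n)%:R by rewrite ltr0n expn_gt0 K0.
rewrite -(ler_pM2l Kn) -{1}(gtr0_norm Kn) -normrM mulrBr -!sum_letter_avg.
rewrite (perm_big _ (perm_to_rem (full a a))) [X in _ - X](perm_big _ (perm_to_rem (full b a))) /=.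
rewrite !big_cons opprD addrACA subrr add0r.
apply: le_trans (sum_oscillation_le fd _) _.
  by rewrite !size_rem // !(size_subst_iter len).
rewrite size_rem // (size_subst_iter len) mulrA mulrBr mulr1 divff ?gt_eqF //.
by rewrite -subn1 natrB // expn_gt0 K0.
Qed.

End Averages.

Lemma geometric_small (R : realType) (q d e : R) :
  0 <= q -> q < 1 -> 0 < e -> exists m : nat, q ^+ m * d <= e.
Proof.
move=> q0 q1 e0.
have q1' : `|q| < 1 by rewrite ger0_norm.
have /cvgrPdist_le/(_ e e0)[m _ /(_ m (leqnn m))] := cvg_geometric d q1'.
rewrite /= sub0r normrN => h; exists m.
by rewrite mulrC (le_trans (ler_norm _) h).
Qed.

(** * Decay of oscillations and sums along the language *)
Section Oscillation.
Context {R : realType} {A : finType} (S : substitution A).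
Context (K : nat) (len : constant_length S K) (prim : primitive S).
Implicit Type f : A -> R.
Local Notation Q := (letter_avg S K).

Let K0 : (0 < K)%N. Proof. by case: len => /ltnW. Qed.
Let K1 : (1 < K)%N. Proof. by case: len. Qed.

Lemma letter_avg_oscillation_small f (e : R) : 0 < e ->
  exists n, forall a b, `|iter n Q f a - iter n Q f b| <= e.
Proof.
move=> e0; have [n n0 full] := primitive_mem_subst_iter prim.
pose d := \sum_a \sum_b `|f a - f b|.
have fd a b : `|f a - f b| <= d.
  rewrite /d (bigD1 a) //= (bigD1 b) //= -addrA lerDl addr_ge0 //.
    by apply: sumr_ge0.
  by apply: sumr_ge0 => i _; apply: sumr_ge0.
pose q : R := 1 - (K ^ n)%:R^-1.
have Kn : (1 : R) < (K ^ n)%:R by rewrite ltr1n -(exp1n n) ltn_exp2r.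
have q0 : 0 <= q by rewrite subr_ge0 invf_le1 ?ltW // (lt_trans ltr01).
have q1 : q < 1 by rewrite ltrBlDr ltrDl invr_gt0 (lt_trans ltr01).
have [m hm] := geometric_small d q0 q1 e0; exists (m * n)%N => a b.
apply: le_trans hm; elim: m a b => [|m IH] a b; first by rewrite expr0 mul1r.
rewrite mulSn !iterD exprS -mulrA.
exact: letter_avg_contraction.
Qed.

(** With g the n-th iterate at f, the left side is g(b) minus a mean of values
of g. *)
Lemma iter_letter_avg_coboundary f n d :
  (forall a b, `|iter n Q f a - iter n Q f b| <= d) ->
  forall b, `|iter n Q (fun c => f c - Q f c) b| <= d.
Proof.
move=> fd b; rewrite iter_letter_avgB -iterSr iterS.
move: (iter n Q f) fd => g gd; rewrite {}/letter_avg.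
have KR : (0 : R) < K%:R by rewrite ltr0n.
rewrite -(ler_pM2l KR) -{1}(gtr0_norm KR) -normrM mulrBr [X in _ - X]mulrC divfK ?gt_eqF //.
have sK : size (S b) = K by case: len.
have -> : K%:R * g b = \sum_(c <- S b) g b.
  by rewrite big_const_seq count_predT sK iter_addr_0 mulr_natl.
rewrite -sumrB (le_trans (ler_norm_sum _ _ _)) //.
rewrite (le_trans (ler_sum _ (fun c _ => gd b c))) //.
by rewrite big_const_seq count_predT sK iter_addr_0 mulr_natl.
Qed.

Lemma sum_word_le (h : A -> R) (B : R) (u : seq A) :
  (forall a, `|h a| <= B) -> `|\sum_(c <- u) h c| <= (size u)%:R * B.
Proof.
move=> hB; rewrite (le_trans (ler_norm_sum _ _ _)) //.
rewrite (le_trans (ler_sum _ (fun c _ => hB c))) //.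
by rewrite big_const_seq count_predT iter_addr_0 mulr_natl.
Qed.

(** Full blocks S^n(b) contribute at most e per letter; only the last,
incomplete block is estimated with the crude bound B. *)
Lemma prefix_sum_le n h (B e : R) u v : 0 <= e -> 0 <= B ->
  (forall a, `|h a| <= B) -> (forall a, `|iter n Q h a| <= e) ->
  prefix u (iter n (subst_ext S) v) ->
  `|\sum_(c <- u) h c| <= (K ^ n)%:R * B + (size u)%:R * e.
Proof.
move=> e0 B0 hB he; elim: v u => [|a v IH] u.
  rewrite iter_subst_ext_nil prefixs0 => /eqP ->.
  by rewrite big_nil normr0 mul0r addr0 mulr_ge0.
rewrite iter_subst_ext_cons => /prefixP[t Et].
have sz : size (subst_iter S n a) = (K ^ n)%N by rewrite (size_subst_iter len).
have [us|su] := leqP (size u) (K ^ n).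
  rewrite (le_trans (sum_word_le _ hB)) // -[leLHS]addr0 lerD ?mulr_ge0 //.
  by rewrite ler_wpM2r // ler_nat.
have Eu : u = subst_iter S n a ++ drop (K ^ n) u.
  rewrite -{1}[u](cat_take_drop (K ^ n)); congr (_ ++ _).
  have := congr1 (take (K ^ n)) Et.
  by rewrite takel_cat ?(ltnW su) // take_size_cat // => <-.
have pu : prefix (drop (K ^ n) u) (iter n (subst_ext S) v).
  apply/prefixP; exists t; move: Et; rewrite {1}Eu -catA => /eqP.
  by rewrite eqseq_cat // eqxx /= => /eqP.
rewrite {1}Eu big_cat /= (le_trans (ler_normD _ _)) //.
have -> : (size u)%:R = (K ^ n)%:R + (size (drop (K ^ n) u))%:R :> R.
  by rewrite -natrD {1}Eu size_cat sz.
rewrite mulrDl [leRHS]addrCA lerD ?IH //.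
by rewrite (sum_letter_avg len) normrM normr_nat ler_wpM2l.
Qed.

(** As [prefix_sum_le], with an incomplete block at either end. *)
Lemma infix_sum_le n h (B e : R) u v : 0 <= e -> 0 <= B ->
  (forall a, `|h a| <= B) -> (forall a, `|iter n Q h a| <= e) ->
  infix u (iter n (subst_ext S) v) ->
  `|\sum_(c <- u) h c| <= 2 * (K ^ n)%:R * B + (size u)%:R * e.
Proof.
move=> e0 B0 hB he; move=> /infixP[s [t]]; elim: v s => [|a v IH] s.
  rewrite iter_subst_ext_nil; case: s u => [|//] [|//] _.
  by rewrite big_nil normr0 mul0r addr0 !mulr_ge0.
rewrite iter_subst_ext_cons => Et.
have sz : size (subst_iter S n a) = (K ^ n)%N by rewrite (size_subst_iter len).
have [Ks|sK] := leqP (K ^ n) (size s).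
  apply: (IH (drop (K ^ n) s)); have := congr1 (drop (K ^ n)) Et.
  rewrite (drop_size_cat _ sz) drop_cat; case: ltngtP Ks => // Ks _.
  by rewrite Ks subnn drop0 drop_size.
have [us|su] := leqP (size u) (K ^ n).
  rewrite (le_trans (sum_word_le _ hB)) // -[leLHS]addr0 lerD ?mulr_ge0 //.
  by rewrite ler_wpM2r // -natrM ler_nat mulSn mul1n (leq_trans us) ?leq_addr.
pose k := (K ^ n - size s)%N.
have ku : (k <= size u)%N by rewrite (leq_trans (leq_subr _ _)) // ltnW.
have pu : prefix (drop k u) (iter n (subst_ext S) v).
  apply/prefixP; exists t; have := congr1 (drop (K ^ n)) Et.
  rewrite (drop_size_cat _ sz) drop_cat ltnNge (ltnW sK) /= -/k drop_cat.
  case: ltngtP ku => // ku _.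
  by rewrite ku drop_size subnn drop0.
rewrite -[in leLHS](cat_take_drop k u) big_cat /= (le_trans (ler_normD _ _)) //.
rewrite -mulrA mulr_natl mulr2n -addrA lerD //.
  rewrite (le_trans (sum_word_le _ hB)) // ler_wpM2r // ler_nat.
  by rewrite size_takel // leq_subr.
rewrite (le_trans (prefix_sum_le e0 B0 hB he pu)) // lerD2l ler_wpM2r // ler_nat.
by rewrite size_drop leq_subr.
Qed.

(** Averages of f - Q f along the words of a given large length are uniformly
small; it is this uniformity that replaces unique ergodicity. *)
Lemma language_sum_small f (e : R) : 0 < e ->
  exists L : nat, forall u, language S u -> size u = L.+1 ->
    `|\sum_(c <- u) (f c - Q f c)| <= L.+1%:R * e.
Proof.
move=> e0; have e20 : 0 < e / 2 by rewrite divr_gt0.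
have [n /iter_letter_avg_coboundary hn] := letter_avg_oscillation_small f e20.
pose h c := f c - Q f c; pose B := \sum_a `|h a|.
have B0 : 0 <= B by apply: sumr_ge0.
have hB a : `|h a| <= B by rewrite /B (bigD1 a) //= lerDl sumr_ge0.
pose C := 2 * (K ^ n)%:R * B.
(* L >= K^n forces m >= n below, and L >= 2 C / e lets half of the error
   absorb the two partial blocks. *)
pose L := maxn (K ^ n) (Num.truncn (2 * C / e)).
exists L => u [m [a]] um su.
have nm : (n <= m)%N.
  rewrite leqNgt; apply/negP => mn; have := size_infix um.
  rewrite su (size_subst_iter len) leqNgt ltnS leq_max.
  by rewrite leq_exp2l // (ltnW mn).
have um' : infix u (iter n (subst_ext S) (subst_iter S (m - n) a)).
  by rewrite /subst_iter -iterD subnKC.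
rewrite (le_trans (infix_sum_le (ltW e20) B0 hB hn um')) // su -/C.
suff : C <= L.+1%:R * (e / 2) by lra.
rewrite mulrA ler_pdivlMr // -ler_pdivrMr // [C * 2]mulrC.
by rewrite (le_trans (ltW (truncnS_gt _))) // ler_nat ltnS leq_maxr.
Qed.
End Oscillation.

(** * The expansion factor *)
Section Eigen.
Context {A : finType} (S : substitution A) (K : nat).
Context (len : constant_length S K).

Lemma sum_count_mem (s : seq A) : (\sum_(x in A) count_mem x s = size s)%N.
Proof.
elim: s => [|c s IH] /=; first by rewrite big1.
rewrite big_split /= IH -add1n; congr addn.
by rewrite (bigD1 c) //= eqxx big1 // => b /negPf; rewrite eq_sym => ->.
Qed.

Lemma substitution_matrix_column_sum (F : pzSemiRingType) j :
  \sum_i substitution_matrix S F i j = K%:R.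
Proof.
have [_ /(_ (enum_val j)) <-] := len.
under eq_bigr do rewrite mxE; rewrite -natr_sum; congr _%:R.
by rewrite -sum_count_mem [RHS]big_enum_val.
Qed.

(** The columns of the matrix sum to K, so K is an eigenvalue, with the all-ones
left eigenvector; and comparing a left eigenvector with its entry of largest
modulus shows that no eigenvalue exceeds K in modulus. *)
Lemma perron_frobenius_constant_length (R : realType) (lam : R) (a0 : A) :
  perron_frobenius_eigenvalue S lam -> lam = K%:R.
Proof.
case=> /eigenvalueP[v vM v0] max.
have cardA : (0 < #|A|)%N by apply/card_gt0P; exists a0.
have Keig : eigenvalue (substitution_matrix S R[i]) K%:R.
  apply/eigenvalueP; exists (const_mx 1).
    apply/rowP => j; rewrite !mxE mulr1.
    under eq_bigr do rewrite mxE mul1r.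
    exact: substitution_matrix_column_sum.
  apply/eqP => /rowP/(_ (Ordinal cardA)); rewrite !mxE => /eqP.
  by rewrite oner_eq0.
have Klam : K%:R <= lam.
  have := max _ Keig; rewrite normr_nat.
  by rewrite -(rmorph_nat (real_complex R)) lecR.
apply/le_anti; rewrite Klam andbT.
(* The moduli are compared through their real parts, since the order of R[i]
   is partial. *)
pose i0 := [arg max_(i > Ordinal cardA) complex.Re `|v 0 i|]%O.
have vle j : `|v 0 j| <= `|v 0 i0|.
  rewrite -(RRe_real (normr_real (v 0 j))) -(RRe_real (normr_real (v 0 i0))) lecR.
  by rewrite /i0; case: arg_maxP => // i _; apply.
have v0' : 0 < `|v 0 i0|.
  rewrite normr_gt0; apply: contra_neq v0 => vi0; apply/rowP => j; rewrite mxE.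
  by apply/eqP; rewrite -normr_le0 (le_trans (vle j)) // vi0 normr0.
have /rowP/(_ i0) := vM; rewrite !mxE => /(congr1 Num.norm).
rewrite normrM => E.
have lam0 : 0 <= lam by rewrite (le_trans _ Klam).
have : `|lam%:C%C| * `|v 0 i0| <= K%:R * `|v 0 i0|.
  rewrite -E (le_trans (ler_norm_sum _ _ _)) //.
  rewrite -(substitution_matrix_column_sum _ i0) mulr_suml ler_sum // => k _.
  rewrite normrM mulrC mxE normr_nat ler_wpM2l //.
rewrite ler_pM2r // ger0_norm; last by rewrite lecR.
by rewrite -(rmorph_nat (real_complex R)) lecR.
Qed.
End Eigen.

(** * Measurability in the sequence space *)
Section Measure.
Context {A : finType} (S : substitution A) (a0 : A).

Lemma measurable_letter (k : int) (a : A) :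
  measurable ([set t | t k = a] : set (borel_biseq a0)).
Proof.
apply: sub_sigma_algebra; rewrite /biseq_open /=.
have -> : [set t : borel_biseq a0 | t k = a] =
  (@proj int (fun=> discrete_topology A) k) @^-1` [set a] by [].
pose D := discrete_topology A.
have ck : continuous (fun t : {ptws int -> D} => (t k : D)).
  by move=> t; exact: (@proj_continuous int (fun=> D) k t).
by move: ck; rewrite continuousP => /(_ [set a]); apply; exact: discrete_open.
Qed.

Lemma measurable_word (s : seq int) (P : set (seq A)) :
  measurable ([set t | P [seq t k | k <- s]] : set (borel_biseq a0)).
Proof.
elim: s P => [|k s IH] P /=.
  have [H|H] := pselect (P [::]).
    by rewrite (_ : [set _ | _] = setT) //; apply/seteqP; split.
  by rewrite (_ : [set _ | _] = set0) //; apply/seteqP; split.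
rewrite (_ : [set _ | _] = \bigcup_(a in [set: A])
    ([set t : borel_biseq a0 | t k = a]
       `&` [set t | P (a :: [seq t k | k <- s])])).
  apply: fin_bigcup_measurable => // a _.
  by apply: measurableI; [exact: measurable_letter|exact: IH [set w | P (a :: w)]].
apply/seteqP; split => t /=; first by exists (t k).
by case=> a _ [/= ->].
Qed.

(** The sequence space is a countable intersection of cylinder sets, one for
each window of coordinates. *)
Lemma measurable_subst_space :
  measurable (subst_space S : set (borel_biseq a0)).
Proof.
pose D (p : int * nat) : set (borel_biseq a0) :=
  [set t | language S [seq t k | k <- [seq p.1 + i%:Z | i <- iota 0 p.2]]].
have -> : (subst_space S : set (borel_biseq a0)) = ~` \bigcup_p ~` D p.
  rewrite setC_bigcup; apply/seteqP; split=> t.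
    by move=> St [k n] _; rewrite setCK /D /= -map_comp; exact: St.
  by move=> H k n; have := H (k, n) I; rewrite setCK /D /= -map_comp.
apply/measurableC/countable_bigcupT_measurable => //.
by move=> p; apply: measurableC; exact: measurable_word.
Qed.
End Measure.

(** * The letter masses form an eigenvector *)
Lemma sum_fine_measure_fiber d (T : measurableType d) (R : realType)
    (mu : probability T R) (I : finType) (G : T -> I) (E : set T) :
  measurable E -> (forall i, measurable [set t | G t = i]) ->
  \sum_i fine (mu (E `&` [set t | G t = i])) = fine (mu E).
Proof.
move=> mE mG; have mEG i : measurable (E `&` [set t | G t = i]).
  exact: measurableI.
rewrite sum_fine => [|i _]; last exact: fin_num_measure.
rewrite (fsbig_seq _ _ (index_enum_uniq I)) -measure_fin_bigcup //.
- congr (fine (mu _)); apply/seteqP; split=> t; first by case=> i _ [].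
  by move=> Et; exists (G t) => //=; rewrite mem_index_enum.
- by move=> i j _ _ [t [[_ <-] [_ <-]]].
Qed.

Section LetterMass.
Context {R : realType} {A : finType} (S : substitution A) (a0 : A).
Context (mu : probability (borel_biseq a0) R) (inv : invariant_probability S mu).
Local Notation m := (letter_mass S mu).
Local Notation Sigma := (subst_space S : set (borel_biseq a0)).

Lemma measure_subst_spaceI (E : set (borel_biseq a0)) : measurable E ->
  mu (Sigma `&` E) = mu E.
Proof.
move=> mE; have mS := @measurable_subst_space A S a0.
have [S1 _] := inv.
rewrite [RHS](measureDI mu mE mS) setIC -[LHS]add0e; congr (_ + _)%E.
apply/esym/(@subset_measure0 _ _ _ mu _ (~` Sigma)).
- exact: measurableD.
- exact: measurableC.
- by move=> t [].
- by have := probability_setC mu mS; rewrite S1 subee.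
Qed.

Lemma letter_mass_coord (n : nat) a :
  fine (mu (Sigma `&` [set t | t n%:Z = a])) = m a.
Proof.
rewrite /letter_mass measure_subst_spaceI; last exact: measurable_letter.
rewrite -/(Sigma `&` [set t | t 0 = a]) measure_subst_spaceI; last exact: measurable_letter.
congr fine; elim: n => // n <-.
have [_ /(_ _ (@measurable_letter A a0 n%:Z a)) <-] := inv.
by congr (mu _); apply/seteqP; split=> t /=; rewrite /bishift intS addrC.
Qed.

Lemma letter_mass_ge0 a : 0 <= m a.
Proof. exact: fine_ge0. Qed.

Lemma letter_mass_le1 a : m a <= 1.
Proof.
have mE : measurable (Sigma `&` [set t | t 0 = a]).
  by apply: measurableI; [exact: measurable_subst_space|exact: measurable_letter].
by rewrite -lee_fin fineK ?fin_num_measure // probability_le1.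
Qed.

Section WordMass.
Context (N : nat).
Let G (t : borel_biseq a0) : {ffun 'I_N -> A} := [ffun i : 'I_N => t (i : nat)%:Z].
Let word_mass (u : {ffun 'I_N -> A}) := fine (mu (Sigma `&` [set t | G t = u])).

Let measurable_word_fiber u : measurable [set t | G t = u].
Proof.
rewrite (_ : [set _ | _] = \bigcap_(i in [set: 'I_N])
    [set t : borel_biseq a0 | t (i : nat)%:Z = u i]).
  by apply: fin_bigcap_measurable => // i _; exact: measurable_letter.
apply/seteqP; split=> t /=; first by move=> <- i _ /=; rewrite ffunE.
by move=> H; apply/ffunP => i; rewrite ffunE; exact: H.
Qed.

Let letter_mass_word a (i : 'I_N) : m a = \sum_(u : {ffun 'I_N -> A} | u i == a) word_mass u.
Proof.
rewrite -(letter_mass_coord i a) -(sum_fine_measure_fiber mu _ measurable_word_fiber); last first.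
  by apply: measurableI; [exact: measurable_subst_space|exact: measurable_letter].
rewrite (bigID (fun u : {ffun _ -> _} => u i == a)) /= [X in _ + X]big1 ?addr0.
  apply: eq_bigr => u /eqP ua; congr (fine (mu _)); rewrite -setIA.
  congr (_ `&` _); apply/seteqP; split=> t /=; first by case.
  by move=> Gt; split=> //; rewrite -ua -Gt ffunE.
move=> u ua; rewrite (_ : _ `&` _ = set0) ?measure0 //.
apply/seteqP; split=> t //= [[_ ta] Gt]; move/eqP: ua; apply.
by rewrite -Gt ffunE.
Qed.

Let sum_word_mass : \sum_u word_mass u = 1.
Proof.
rewrite (sum_fine_measure_fiber mu _ measurable_word_fiber).
  by have [-> _] := inv.
exact: measurable_subst_space.
Qed.

(** By invariance each of the N coordinates has the letter masses as its law, so
N times the mean of h is the mean of the sum of h along the window of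
coordinates 0, ..., N - 1, which spells a word of the language. *)
Lemma letter_mass_sum_le (h : A -> R) (e : R) :
  (forall u, language S u -> size u = N -> `|\sum_(c <- u) h c| <= e) ->
  `|N%:R * \sum_a m a * h a| <= e.
Proof.
move=> he.
have -> : N%:R * \sum_a m a * h a = \sum_u word_mass u * \sum_i h (u i).
  under [RHS]eq_bigr do rewrite mulr_sumr.
  rewrite exchange_big /= mulr_natl -[in LHS](card_ord N) -sumr_const.
  apply: eq_bigr => i _; rewrite (partition_big (fun u : {ffun _ -> _} => u i) predT) //=.
  apply: eq_bigr => a _; rewrite (letter_mass_word a i) mulr_suml.
  by apply: eq_bigr => u /eqP ->.
rewrite (le_trans (ler_norm_sum _ _ _)) // -[leRHS]mul1r -sum_word_mass mulr_suml.
apply: ler_sum => u _; have m0 : 0 <= word_mass u by exact: fine_ge0.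
rewrite normrM ger0_norm //.
have [Su0|/set0P[t [St Gt]]] := eqVneq (Sigma `&` [set t | G t = u]) set0.
  by rewrite /word_mass Su0 measure0 !mul0r.
rewrite ler_wpM2l //.
have := he _ (St 0 N); rewrite size_map size_iota big_map => /(_ erefl).
rewrite -{1}[N]subn0 -/(index_iota 0 N) big_mkord.
under eq_bigr do rewrite add0r.
by rewrite -Gt; under [in X in _ -> X]eq_bigr do rewrite ffunE.
Qed.
End WordMass.

(** The difference of the two sides is the mean of f - Q f, which
[language_sum_small] and [letter_mass_sum_le] make smaller than any e > 0. *)
Lemma letter_mass_avg (K : nat) (len : constant_length S K) (prim : primitive S)
    (f : A -> R) :
  \sum_a m a * f a = \sum_a m a * letter_avg S K f a.
Proof.
apply/eqP; rewrite -subr_eq0 -normr_le0; apply/ler_addgt0Pr => e e0.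
rewrite add0r -sumrB; under eq_bigr do rewrite -mulrBr.
have [L HL] := language_sum_small len prim f e0.
have := letter_mass_sum_le HL.
by rewrite normrM normr_nat ler_pM2l // ltr0n.
Qed.

(** This is [letter_mass_avg] for the indicator function of a. *)
Lemma letter_mass_incoming (K : nat) (len : constant_length S K)
    (prim : primitive S) (a : A) (s : seq (A * nat)) :
  uniq s -> s =i incoming S a -> \sum_(p <- s) m p.1 / K%:R = m a.
Proof.
move=> us sE; have := letter_mass_avg len prim (fun c => (c == a)%:R).
rewrite (bigD1 a) //= eqxx mulr1 big1 ?addr0 => [->|b /negPf ->]; last by rewrite mulr0.
have [_ sK] := len.
have /(perm_big _) -> : perm_eq s
    [seq p <- [seq (b, j) | b <- index_enum A, j <- iota 0 K] | p \in incoming S a].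
  apply: uniq_perm => //.
    rewrite filter_uniq // allpairs_uniq ?index_enum_uniq ?iota_uniq //.
    by move=> [? ?] [? ?] _ _ [-> ->].
  move=> [b j]; rewrite sE mem_filter andb_idr // inE /= sK => /andP[jK _].
  by apply: allpairs_f; rewrite ?mem_index_enum // mem_iota.
rewrite big_filter big_mkcond big_allpairs_dep /=; apply: eq_bigr => b _.
rewrite /letter_avg (big_nth a) sK mulr_suml mulr_sumr /index_iota subn0.
apply: eq_big_seq => j; rewrite mem_iota add0n inE /= /subst_letter sK => jK.
rewrite jK (set_nth_default a) ?sK //.
by case: eqP => _; rewrite ?mul1r ?mul0r ?mulr0.
Qed.
End LetterMass.

(** * Subdividing an interval in a given order *)
Section Subdivision.
Context {R : realDomainType} {T : eqType} (v : T -> R).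
Implicit Type s : seq T.

(** The left endpoint of the cell of p when cells of lengths v are laid side by
side in the order of s. *)
Definition offset s p : R := \sum_(q <- take (index p s) s) v q.

Lemma offset_head q s : offset (q :: s) q = 0.
Proof. by rewrite /offset /= eqxx big_nil. Qed.

Lemma offset_behead q s p : q != p -> offset (q :: s) p = v q + offset s p.
Proof. by move=> /negPf qp; rewrite /offset /= qp big_cons. Qed.

Context (v_ge0 : forall p, 0 <= v p).

Lemma offset_ge0 s p : 0 <= offset s p.
Proof. exact: sumr_ge0. Qed.

Lemma offset_cell_le s p : p \in s -> offset s p + v p <= \sum_(q <- s) v q.
Proof.
elim: s => // q s IH; rewrite in_cons big_cons.
have [<- _|qp] := eqVneq p q.
  by rewrite offset_head add0r lerDl sumr_ge0.
by move=> ps; rewrite offset_behead 1?eq_sym // -addrA lerD2l IH.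
Qed.

Lemma offset_cell_exists s y : uniq s -> 0 <= y < \sum_(q <- s) v q ->
  exists2 p, p \in s & 0 <= y - offset s p < v p.
Proof.
elim: s y => [|q s IH] y /=; first by rewrite big_nil => _ /andP[/le_lt_trans h /h]; rewrite ltxx.
case/andP=> qs us; rewrite big_cons => /andP[y0 y1].
have [yq|qy] := ltP y (v q).
  by exists q; rewrite ?mem_head // offset_head subr0 y0.
have [|p ps] := IH (y - v q) us; first by rewrite subr_ge0 qy ltrBlDl.
rewrite -addrA -opprD => h; exists p; first by rewrite in_cons ps orbT.
by rewrite offset_behead //; apply: contraNneq qs => ->.
Qed.

Lemma offset_cell_unique s y p q : p \in s -> q \in s ->
  0 <= y - offset s p < v p -> 0 <= y - offset s q < v q -> p = q.
Proof.
elim: s y => // r s IH y; rewrite !in_cons.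
have [->|pr] := eqVneq p r; have [->|qr] := eqVneq q r => //=.
- rewrite offset_head offset_behead 1?eq_sym // subr0 => _ _ /andP[_ yp] /andP[yq _].
  by exfalso; have := offset_ge0 s q; lra.
- rewrite offset_head offset_behead 1?eq_sym // subr0 => _ _ /andP[yq _] /andP[_ yp].
  by exfalso; have := offset_ge0 s p; lra.
- by rewrite !offset_behead 1?eq_sym // !opprD !addrA; exact: IH.
Qed.
End Subdivision.

(** * A pigeonhole principle for sets of reals *)

(** Among #|T| + 1 distinct points of X some two have the same image, yet they
are at least as far apart as the closest pair. *)
Lemma card_le_small_fibers (R : realType) (T : finType) (X : set R) :
  (forall e : R, 0 < e -> exists f : R -> T,
     forall x y, X x -> X y -> f x = f y -> `|x - y| < e) ->
  (X #<= `I_#|T|)%card.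
Proof.
move=> small; apply: contrapT => XT.
have : (`I_#|T|.+1 #<= X)%card.
  have [/finite_setP[n Xn]|/infiniteP NX] := pselect (finite_set X); last first.
    exact: card_le_trans (card_leT _) NX.
  rewrite (card_le_eqr Xn) card_le_II ltnNge; apply/negP => nT; apply: XT.
  by rewrite (card_le_eql Xn) card_le_II.
case/pcard_leP => g; pose d (p : 'I_#|T|.+1 * 'I_#|T|.+1) := `|g p.1 - g p.2|.
pose e := \big[Num.min/1]_(p | p.1 != p.2) d p.
have e0 : 0 < e.
  apply: lt_bigmin => // -[i j] /= ij; rewrite normr_gt0 subr_eq0.
  apply: contra_neq ij => gij; apply/val_inj.
  by apply: (@inj _ _ _ g) gij; rewrite mem_setE; exact: ltn_ord.
have [f fP] := small e e0.
have finj : injective (fun i : 'I_#|T|.+1 => f (g i)).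
  have gX (k : 'I_#|T|.+1) : X (g k) by apply: (@funS _ _ _ _ g) => /=.
  move=> i j fij; apply/eqP/negPn/negP => ij.
  have := fP _ _ (gX i) (gX j) fij; rewrite ltNge => /negP; apply.
  exact: (bigmin_le_cond _ (j := (i, j))).
by have := leq_card _ finj; rewrite card_ord ltnn.
Qed.

(** * Addresses as base-K integers *)
Section Addresses.
Context {A : finType} (S : substitution A).
Context (K : nat) (len : constant_length S K).
Implicit Types (a b : nat -> A * nat) (p : A * nat).

Let sizeK c : size (S c) = K. Proof. by case: len. Qed.
Let K_gt0 : (0 < K)%N. Proof. by case: len => /ltnW. Qed.

Definition target p : A := subst_letter S p.1 p.2.

Definition eventually_final a : Prop :=
  exists N, forall k, (N <= k)%N -> ~~ non_final S (a k).

Lemma infinite_address_digit a k : infinite_address S a -> ((a k).2 < K)%N.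
Proof. by case=> /(_ k); rewrite sizeK. Qed.

Lemma target_succ a k : infinite_address S a -> target (a k.+1) = (a k).1.
Proof. by case=> _ /(_ k); rewrite inE => /andP[_ /eqP]. Qed.

Lemma final_digit a k : infinite_address S a ->
  ~~ non_final S (a k) -> (a k).2 = K.-1.
Proof.
move=> infa; have aK := infinite_address_digit k infa; rewrite /non_final sizeK -leqNgt => Ka.
by apply/eqP; rewrite eqn_leq Ka andbT -ltnS prednK.
Qed.

Definition address_val a n : nat := (\sum_(k < n) (a k).2 * K ^ k)%N.

Lemma address_valS a n : address_val a n.+1 = ((a n).2 * K ^ n + address_val a n)%N.
Proof. by rewrite /address_val big_ord_recr addnC. Qed.

Lemma address_val_lt a n : infinite_address S a -> (address_val a n < K ^ n)%N.
Proof.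
move=> infa; elim: n => [|n IH]; first by rewrite /address_val big_ord0.
rewrite address_valS expnS; have := infinite_address_digit n infa.
move: (a n).2 (K ^ n)%N IH => j M; nia.
Qed.

Lemma address_val_digits a b n : infinite_address S a -> infinite_address S b ->
  address_val a n = address_val b n -> forall k, (k < n)%N -> (a k).2 = (b k).2.
Proof.
move=> infa infb; elim: n => // n IH; rewrite !address_valS => E.
have := congr1 (modn^~ (K ^ n)%N) E; have := congr1 (divn^~ (K ^ n)%N) E.
have Kn : (0 < K ^ n)%N by rewrite expn_gt0 K_gt0.
rewrite /= !modnMDl !divnMDl // !modn_small ?address_val_lt // !divn_small ?address_val_lt //.
rewrite !addn0 => En /IH{}IH k; rewrite ltnS leq_eqVlt => /orP[/eqP ->//|].
exact: IH.
Qed.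

(** Addresses are read backwards: the letter of an entry is the target of the
next entry, so its digit completes it. *)
Lemma address_eq_prefix a b n : infinite_address S a -> infinite_address S b ->
  target (a n) = target (b n) -> (forall k, (k < n)%N -> (a k).2 = (b k).2) ->
  target (a 0) = target (b 0) /\ forall k, (k < n)%N -> a k = b k.
Proof.
move=> infa infb; elim: n => [|n IH] tab dab; first by split.
have ab : a n = b n.
  rewrite [a n]surjective_pairing [b n]surjective_pairing -!target_succ // tab.
  by rewrite dab.
have [||t0 abk] := IH; first by rewrite ab.
  by move=> k kn; apply: dab; rewrite ltnS ltnW.
by split=> // k; rewrite ltnS leq_eqVlt => /orP[/eqP ->//|]; exact: abk.
Qed.

Lemma zero_addressE n c :
  zero_address S n c =
    mkseq (fun k => (iter (n - k.+1) (subst_letter S ^~ 0%N) c, 0%N)) n.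
Proof.
elim: n c => //= n IH c; rewrite IH mkseqS subnn /=; congr rcons.
apply/eq_in_map => k; rewrite mem_iota add0n /= => kn.
by rewrite subSn // iterSr.
Qed.

(** The value of the Vershik map at an infinite address whose first non-final
entry has index m. *)
Definition successor a m k : A * nat :=
  let c := subst_letter S (a m).1 (a m).2.+1 in
  if (k < m)%N then (iter (m - k.+1) (subst_letter S ^~ 0%N) c, 0%N)
  else if k == m then ((a m).1, (a m).2.+1) else a k.

Section Successor.
Context (a : nat -> A * nat) (m : nat).
Context (infa : infinite_address S a).
Context (nonfinal_m : non_final S (a m)).
Context (final_lt_m : forall k, (k < m)%N -> ~~ non_final S (a k)).

Lemma vershik_mkseq : vershik S (mkseq a m.+1) = mkseq (successor a m) m.+1.
Proof.
have findm : find (non_final S) (mkseq a m.+1) = m.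
  rewrite mkseqS -cats1 find_cat /= nonfinal_m addn0 size_mkseq.
  case: hasP => // -[p /mapP[k + ->]]; rewrite mem_iota => km.
  by move=> nf; have := final_lt_m km; rewrite nf.
rewrite /vershik findm mkseqS -cats1 drop_size_cat ?size_mkseq //.
rewrite [a m]surjective_pairing zero_addressE mkseqS -cats1; congr (_ ++ [:: _]).
  apply/eq_in_map => k; rewrite mem_iota add0n /= => km.
  by rewrite /successor km.
by rewrite /successor ltnn eqxx.
Qed.

Lemma successor_gt k : (m < k)%N -> successor a m k = a k.
Proof. by rewrite /successor => mk; rewrite ltnNge (ltnW mk) gtn_eqF. Qed.

Lemma infinite_address_successor : infinite_address S (successor a m).
Proof.
have bounded k : ((successor a m k).2 < size (S (successor a m k).1))%N.
  rewrite /successor; case: ifP => _ /=; first by rewrite sizeK.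
  case: eqP => _; last by case: infa.
  by move: nonfinal_m; rewrite /non_final sizeK /= -ltnS prednK.
split=> // k; rewrite inE bounded /=.
rewrite /successor; case: (ltngtP k.+1 m) => [km|mk|km].
- by rewrite -(subnSK km) /=.
- have -> : (if k == m then ((a m).1, (a m).2.+1) else a k).1 = (a k).1.
    by case: eqP => // ->.
  by apply/eqP/target_succ.
- by rewrite /= km subnn.
Qed.

(** The carry rule of the odometer.  Below the first non-final entry all digits
are K - 1, so the value there is K^n - 1 and becomes 0; from that entry on the
value increases by exactly 1. *)
Lemma address_val_successor n :
  address_val (successor a m) n = (address_val a n).+1 %[mod K ^ n].
Proof.
have low l : (l <= m)%N -> address_val (successor a m) l = 0%N /\
    (address_val a l).+1 = (K ^ l)%N.
  elim: l => [|l IH] lm; first by rewrite /address_val !big_ord0 expn0.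
  have [v0 v1] := IH (ltnW lm); rewrite !address_valS v0 /successor lm /= mul0n.
  split=> //; rewrite (final_digit infa (final_lt_m lm)) -addnS v1 expnS.
  by rewrite addnC -mulSn prednK.
have high l : (m < l)%N -> address_val (successor a m) l = (address_val a l).+1.
  elim: l => // l IH; rewrite ltnS leq_eqVlt => /orP[/eqP <-|ml].
    rewrite !address_valS; have [-> v1] := low m (leqnn m).
    by rewrite /successor ltnn eqxx /= addn0 -addnS v1 mulSn addnC.
  by rewrite !address_valS IH // successor_gt // addnS.
have [nm|mn] := leqP n m; last by rewrite high.
by have [-> ->] := low n nm; rewrite modnn mod0n.
Qed.

End Successor.
End Addresses.

(** * Addresses of points *)
Section Geometry.
Context {R : realType} {A : finType} (S : substitution A).
Context (K : nat) (len : constant_length S K).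
Context (w : A -> R) (Phi0 : A -> R) (ordT : A -> seq (A * nat)).
Implicit Types (a b : nat -> A * nat) (p : A * nat) (x y : R).

Context (w_ge0 : forall c, 0 <= w c).
Context (w_le1 : forall c, w c <= 1).
Context (Phi0P : left_endpoints_spec w Phi0).
Context (ordTP : orderings_spec S ordT).
Context (w_incoming : forall c, \sum_(p <- ordT c) w p.1 / K%:R = w c).

Local Notation target := (target S).
Local Notation phi := (phi S w K%:R ordT).
Local Notation Phi := (Phi S w K%:R Phi0 ordT).

Let K_gt0 : (0 < K)%N. Proof. by case: len => /ltnW. Qed.
Let KR_gt0 : (0 : R) < K%:R. Proof. by rewrite ltr0n. Qed.
Let KX_gt0 n : (0 : R) < K%:R ^+ n. Proof. by rewrite exprn_gt0. Qed.

Let v p := w p.1 / K%:R.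
Let v_ge0 p : 0 <= v p. Proof. by rewrite divr_ge0. Qed.

Lemma phiE p : phi p = offset v (ordT (target p)) p.
Proof. by []. Qed.

Lemma phi_cell_le c p : p \in incoming S c -> 0 <= phi p /\ phi p + v p <= w c.
Proof.
have [_ Tc] := ordTP c; rewrite -Tc => pc.
have : p \in incoming S c by rewrite -Tc.
rewrite inE phiE => /andP[_ /eqP tp]; rewrite /target tp; split; first exact: offset_ge0.
by rewrite -[leRHS]w_incoming; exact: offset_cell_le.
Qed.

Lemma phi_cell_exists c y : 0 <= y < w c ->
  exists2 p, p \in incoming S c & 0 <= y - phi p < v p.
Proof.
have [uc Tc] := ordTP c; rewrite -w_incoming => /(offset_cell_exists uc)[p pc].
have : p \in incoming S c by rewrite -Tc.
move=> pc'; exists p => //; move: (pc'); rewrite inE => /andP[_ /eqP tp].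
by rewrite phiE /target tp.
Qed.

Lemma phi_cell_unique c y p q : p \in incoming S c -> q \in incoming S c ->
  0 <= y - phi p < v p -> 0 <= y - phi q < v q -> p = q.
Proof.
have [uc Tc] := ordTP c; rewrite -!Tc => pc qc.
have := pc; rewrite Tc inE => /andP[_ /eqP tp].
have := qc; rewrite Tc inE => /andP[_ /eqP tq].
by rewrite !phiE /target tp tq; exact: offset_cell_unique.
Qed.

Definition left_endpoint a n : R :=
  Phi0 (target (a 0)) + \sum_(k < n) phi (a k) / K%:R ^+ k.

(** At level 0 the interval is the cell of the first letter, not the whole
of [0, 1), so that consecutive levels are related in the same way for all n. *)
Definition located a x : Prop :=
  forall n, 0 <= x - left_endpoint a n < w (target (a n)) / K%:R ^+ n.

Lemma left_endpointS a n :
  left_endpoint a n.+1 = left_endpoint a n + phi (a n) / K%:R ^+ n.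
Proof. by rewrite /left_endpoint big_ord_recr addrA. Qed.

Lemma Phi_mkseq a n : Phi (mkseq a n.+1) = left_endpoint a n.+1.
Proof.
rewrite /left_endpoint /Defs.Phi /= size_map size_iota; congr (_ + _).
apply: eq_bigr => k _.
by have := nth_mkseq (a 0) a (ltn_ord k) => /= ->.
Qed.

Lemma Phi0_exists x : 0 <= x < 1 -> exists c, 0 <= x - Phi0 c < w c.
Proof.
case: Phi0P => /seteqP[_ h] _ _ xI.
have [|c _ /=] := h x; first by rewrite /= in_itv.
by rewrite in_itv /= -subr_ge0 -ltrBlDl => ?; exists c.
Qed.

Lemma Phi0_unique x c d : 0 <= x - Phi0 c < w c -> 0 <= x - Phi0 d < w d -> c = d.
Proof.
case: Phi0P => _ /(_ c d I I) h _.
rewrite !subr_ge0 !ltrBlDl => xc xd; apply: h; exists x; split; rewrite /= in_itv //.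
Qed.

Lemma Phi0_cell x c : 0 <= x - Phi0 c < w c -> 0 <= x < 1.
Proof.
case: Phi0P => /seteqP[h _] _ _; rewrite subr_ge0 ltrBlDl => xc.
have : `[0, 1[%classic x by apply: h; exists c => //=; rewrite in_itv.
by rewrite /= in_itv.
Qed.

Lemma target_incoming a n : infinite_address S a -> a n \in incoming S (target (a n)).
Proof. by move=> [/(_ n) h _]; rewrite inE h /= /target eqxx. Qed.

(** In the coordinate (x - left endpoint) * K^n, which runs over [0, w c) at
level n, passing to level n + 1 is choosing a cell of the subdivision
of [0, w c). *)
Lemma located_step a x n : infinite_address S a ->
  (0 <= x - left_endpoint a n.+1 < w (target (a n.+1)) / K%:R ^+ n.+1)
  = (0 <= (x - left_endpoint a n) * K%:R ^+ n - phi (a n) < v (a n)).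
Proof.
move=> infa; rewrite left_endpointS target_succ // opprD addrA exprS invfM mulrA.
set D := x - _; set M := K%:R ^+ n.
have M0 : 0 < M^-1 by rewrite invr_gt0 KX_gt0.
have -> : D - phi (a n) / M = (D * M - phi (a n)) / M.
  by rewrite mulrBl mulfK // gt_eqF // KX_gt0.
by rewrite pmulr_lge0 // ltr_pM2r.
Qed.

Lemma located_scaled a x n :
  (0 <= x - left_endpoint a n < w (target (a n)) / K%:R ^+ n)
  = (0 <= (x - left_endpoint a n) * K%:R ^+ n < w (target (a n))).
Proof. by rewrite pmulr_lge0 ?KX_gt0 // ltr_pdivlMr ?KX_gt0. Qed.

(** The intervals are nested, so membership at a deep level suffices. *)
Lemma located_pred a x n : infinite_address S a ->
  0 <= x - left_endpoint a n.+1 < w (target (a n.+1)) / K%:R ^+ n.+1 ->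
  0 <= x - left_endpoint a n < w (target (a n)) / K%:R ^+ n.
Proof.
move=> infa; rewrite located_step // located_scaled.
by have [] := phi_cell_le (target_incoming n infa); lra.
Qed.

Lemma located_ge a x N : infinite_address S a ->
  (forall n, (N <= n)%N ->
     0 <= x - left_endpoint a n < w (target (a n)) / K%:R ^+ n) ->
  located a x.
Proof.
move=> infa H n; have [/H //|nN] := leqP N n.
have := H N (leqnn N); rewrite -(subnK (ltnW nN)).
by elim: (N - n)%N => // k IH; rewrite addSn => /located_pred/IH; apply.
Qed.

Lemma located_in01 a x : located a x -> 0 <= x < 1.
Proof.
move=> /(_ 0%N); rewrite /left_endpoint big_ord0 addr0 expr0 divr1.
exact: Phi0_cell.
Qed.

Lemma located_unique a b x : infinite_address S a -> infinite_address S b ->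
  located a x -> located b x -> a = b.
Proof.
move=> infa infb la lb.
have E n : left_endpoint a n = left_endpoint b n /\ target (a n) = target (b n) /\ a n = b n.
  have step m : left_endpoint a m = left_endpoint b m -> target (a m) = target (b m) -> a m = b m.
    move=> lm tm; have := la m.+1; have := lb m.+1; rewrite !located_step // lm.
    move=> lb' la'; apply: phi_cell_unique la' lb'; first exact: target_incoming.
    by rewrite tm target_incoming.
  elim: n => [|n [lab [tab ab]]].
    have t0 : target (a 0) = target (b 0).
      have := la 0%N; have := lb 0%N.
      rewrite /left_endpoint !big_ord0 !addr0 !expr0 !divr1 => lb' la'.
      exact: Phi0_unique la' lb'.
    have l0 : left_endpoint a 0 = left_endpoint b 0.
      by rewrite /left_endpoint !big_ord0 t0.
    by split=> //; split=> //; exact: step.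
  have l1 : left_endpoint a n.+1 = left_endpoint b n.+1.
    by rewrite !left_endpointS lab ab.
  have t1 : target (a n.+1) = target (b n.+1) by rewrite !target_succ // ab.
  by split=> //; split=> //; exact: step.
by apply/funext => n; have [_ []] := E n.
Qed.

(** The address is built greedily: the state is the current letter together with
the rescaled coordinate in [0, w c). *)
Lemma located_exists x : 0 <= x < 1 -> exists2 a, infinite_address S a & located a x.
Proof.
move=> /Phi0_exists[c0 xc0].
have /choice[next nextP] (st : A * R) : exists p, 0 <= st.2 < w st.1 ->
    p \in incoming S st.1 /\ 0 <= st.2 - phi p < v p.
  have [/phi_cell_exists[p pc yp]|h] := boolP (0 <= st.2 < w st.1); first by exists p.
  by exists (st.1, 0%N).
pose fix state n : A * R := if n is k.+1 then
  let p := next (state k) in (p.1, ((state k).2 - phi p) * K%:R)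
  else (c0, x - Phi0 c0).
pose a n := next (state n).
have stateP n : 0 <= (state n).2 < w (state n).1.
  elim: n => //= n /nextP[_]; rewrite -/(a n) ltr_pdivlMr // => /andP[h ->].
  by rewrite mulr_ge0.
have aP n : a n \in incoming S (state n).1 by have [] := nextP _ (stateP n).
have ta n : target (a n) = (state n).1.
  by have := aP n; rewrite inE => /andP[_ /eqP].
have infa : infinite_address S a.
  split=> k; first by have := aP k; rewrite inE => /andP[].
  exact: (aP k.+1).
exists a => // n; rewrite located_scaled ta.
suff -> : (x - left_endpoint a n) * K%:R ^+ n = (state n).2 by [].
elim: n => [|n IH]; first by rewrite /left_endpoint big_ord0 addr0 expr0 mulr1 ta.
rewrite /= -/(a n) -IH left_endpointS opprD addrA exprSr mulrA mulrBl divfK //.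
by rewrite gt_eqF.
Qed.

Lemma address_interval_mkseq a n x : infinite_address S a ->
  address_interval S w K%:R Phi0 ordT (mkseq a n.+1) x
  = (0 <= x - left_endpoint a n.+1 < w (target (a n.+1)) / K%:R ^+ n.+1) :> Prop.
Proof.
move=> infa; rewrite target_succ // subr_ge0 ltrBlDl -Phi_mkseq.
have <- : last (a 0) (mkseq a n.+1) = a n by rewrite mkseqS last_rcons.
by rewrite /address_interval /= in_itv /= size_map size_iota.
Qed.

Lemma address_ofE a x : infinite_address S a -> located a x ->
  address_of S w K%:R Phi0 ordT x = Some a.
Proof.
move=> infa lax; apply: xget_unique => [|_ [b [infb bx] <-]].
  exists a => //; split=> // -[|n]; last by rewrite address_interval_mkseq.
  by rewrite /= in_itv /=; exact: located_in01 lax.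
congr Some; apply: located_unique lax => //.
by apply: (@located_ge _ _ 1) => // -[//|n] _; rewrite -address_interval_mkseq.
Qed.

(** * The interval exchange acts as an odometer *)
Definition infinitely_often_nonfinal a :=
  forall N, exists2 k, (N <= k)%N & non_final S (a k).

Lemma left_endpoint_tail a b N n : (N <= n)%N ->
  (forall k, (N <= k)%N -> a k = b k) ->
  left_endpoint b n - left_endpoint b N = left_endpoint a n - left_endpoint a N.
Proof.
move=> Nn ab; rewrite -(subnK Nn); elim: (n - N)%N => [|k IH]; first by rewrite !subrr.
by rewrite addSn !left_endpointS ab ?leq_addl // addrAC IH addrAC.
Qed.

Local Notation F := (iiet S w K%:R Phi0 ordT).

(** The image is the translate of x by the difference of left endpoints at the
level where the address changes.  Deeper entries are unchanged, so this
difference is the same at every deeper level and the image lies in the interval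
of each prefix of the successor address. *)
Lemma iiet_step a x : infinite_address S a -> located a x ->
  infinitely_often_nonfinal a ->
  exists b y, [/\ F x = Some y, infinite_address S b, located b y,
    infinitely_often_nonfinal b
    & forall n, address_val K b n = (address_val K a n).+1 %[mod K ^ n]].
Proof.
move=> infa lax nfa; rewrite /iiet (address_ofE infa lax).
case: pselect => [ex|]; last by case; have [k _ nfk] := nfa 0%N; exists k.
case: ex_minnP => m nfm minm.
have fin k : (k < m)%N -> ~~ non_final S (a k).
  by move=> km; apply: contraL km => /minm; rewrite -leqNgt.
have infb := infinite_address_successor len infa nfm.
exists (successor S a m); eexists; split; first reflexivity.
- exact: infb.
- rewrite vershik_mkseq // !Phi_mkseq.
  apply: (@located_ge _ _ m.+1) => // n mn.
  have -> : successor S a m n = a n by apply: successor_gt.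
  have := left_endpoint_tail mn (fun k mk => esym (successor_gt S a mk)).
  have := lax n; lra.
- move=> N; have [k Nk nfk] := nfa (maxn N m.+1).
  move: Nk; rewrite geq_max => /andP[Nk mk].
  by exists k => //; rewrite successor_gt.
- exact: address_val_successor.
Qed.

Lemma iter_iiet_address a x j : infinite_address S a -> located a x ->
  infinitely_often_nonfinal a ->
  exists b y, [/\ iter_partial F j x = Some y, infinite_address S b, located b y,
    infinitely_often_nonfinal b
    & forall n, address_val K b n = (address_val K a n + j)%N %[mod K ^ n]].
Proof.
move=> infa lax nfa; elim: j => [|j [b [y [Fy infb lby nfb vb]]]].
  by exists a, x; split=> // n; rewrite addn0.
have [c [z [Fz infc lcz nfc vc]]] := iiet_step infb lby nfb.
exists c, z; split=> //; first by rewrite /iter_partial iterS [iter _ _ _]Fy.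
by move=> n; rewrite vc addnS -addn1 -modnDml vb modnDml addn1.
Qed.

(** Adding K^n does not change the residue modulo K^n, hence not the first n
digits. *)
Lemma iter_iiet_prefix a x n : infinite_address S a -> located a x ->
  infinitely_often_nonfinal a ->
  exists b y, [/\ iter_partial F (K ^ n) x = Some y, infinite_address S b, located b y
    & forall k, (k < n)%N -> (b k).2 = (a k).2].
Proof.
move=> infa lax nfa; have [b [y [Fy infb lby _ vb]]] := iter_iiet_address (K ^ n) infa lax nfa.
exists b, y; split=> //; apply: (address_val_digits len) => //.
by have := vb n; rewrite modnDr !modn_small // (address_val_lt len).
Qed.

(** * Accumulation points and the exceptional set *)
Lemma located_close a b x y n : infinite_address S a -> infinite_address S b ->
  located a x -> located b y -> target (a n) = target (b n) ->
  (forall k, (k < n)%N -> (a k).2 = (b k).2) -> `|x - y| < (K%:R ^+ n)^-1.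
Proof.
move=> infa infb lax lby tab dab.
have [t0 ab] := address_eq_prefix infa infb tab dab.
have lab : left_endpoint a n = left_endpoint b n.
  by rewrite /left_endpoint t0; congr (_ + _); apply: eq_bigr => k _; rewrite ab.
have := lax n; have := lby n; rewrite -tab lab.
have : w (target (a n)) / K%:R ^+ n <= (K%:R ^+ n)^-1.
  by rewrite ler_pdivrMr // mulVf // gt_eqF.
rewrite ltr_norml; lra.
Qed.

Lemma level_length_small (e : R) : 0 < e -> exists m : nat, (K%:R ^+ m)^-1 <= e.
Proof.
move=> e0; have Kinv0 : 0 < K%:R^-1 :> R by rewrite invr_gt0.
have Kinv1 : K%:R^-1 < 1 :> R by rewrite invf_lt1 // ltr1n; case: len.
have [m] := geometric_small 1 (ltW Kinv0) Kinv1 e0.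
by rewrite mulr1 exprVn; exists m.
Qed.

(** At scale e, an accumulation point is sorted by the letter that a nearby term
of the sequence, of index at least m, has at level m.  All these terms share
their first m digits, so that letter determines their interval of level m. *)
Lemma cluster_card_le a (b : nat -> nat -> A * nat) (u : nat -> R) :
  (forall n, infinite_address S (b n)) ->
  (forall n, located (b n) (u n)) ->
  (forall n k, (k < n)%N -> (b n k).2 = (a k).2) ->
  (cluster (u @ \oo) #<= `I_#|A|)%card.
Proof.
move=> infb lbu dab; apply: card_le_small_fibers => e e0.
have e30 : 0 < e / 3 by rewrite divr_gt0.
have [m mP] := level_length_small e30.
have /choice[f fP] y : exists n, cluster (u @ \oo) y -> (m <= n)%N /\ `|u n - y| < e / 3.
  have [cy|] := pselect (cluster (u @ \oo) y); last by exists 0%N.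
  have [|_ [[n /= mn <-] /= yn]] := cy (u @` [set n | (m <= n)%N]) (ball y (e / 3)) _ (nbhsx_ballx _ _ e30).
    by exists m => // n /= mn; exists n.
  by exists n => _; split=> //; rewrite distrC.
exists (fun y => target (b (f y) m)) => y z /fP[my uy] /fP[mz uz] tyz.
have : `|u (f y) - u (f z)| < (K%:R ^+ m)^-1.
  apply: located_close tyz _ => // k km.
  by rewrite !dab // (leq_trans km).
move: uy uz; rewrite !ltr_norml; lra.
Qed.

(** Once the digits from index N on are K - 1, only the digits below N and the
letter at level m are free: a number of choices that does not depend on m,
while the intervals shrink.  So each N contributes finitely many points. *)
Lemma eventually_final_countable :
  countable [set x | exists a, [/\ infinite_address S a, located a x & eventually_final S a]].
Proof.
pose X N := [set x | exists a, [/\ infinite_address S a, located a x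
  & forall k, (N <= k)%N -> ~~ non_final S (a k)]].
have -> : [set x | exists a, [/\ infinite_address S a, located a x & eventually_final S a]]
    = \bigcup_N X N.
  apply/seteqP; split=> x.
    by case=> a [infa lax [N HN]]; exists N => //; exists a.
  by case=> N _ [a [infa lax HN]]; exists a; split=> //; exists N.
apply: bigcup_countable => // N _; apply: finite_set_countable.
have [->|/set0P[_ [dflt _]]] := eqVneq (X N) set0; first exact: finite_set0.
(* The digits are below K; 'I_K.+1 is used because its type is inhabited by
   construction, as inord requires. *)
pose T := (A * {ffun 'I_N -> 'I_K.+1})%type.
suff h : (X N #<= `I_#|{: T}|)%card by apply: card_le_finite h _.
apply: card_le_small_fibers => e e0.
have [m mP] := level_length_small e0.
have /choice[addr addrP] (x : R) : exists a, X N x -> [/\ infinite_address S a, located a x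
  & forall k, (N <= k)%N -> ~~ non_final S (a k)].
  have [[a aP]|h] := pselect (X N x); first by exists a.
  by exists dflt.
exists (fun x => (target (addr x m), [ffun i : 'I_N => inord (addr x i).2])).
move=> x y /addrP[infa lax fa] /addrP[infb lby fb] [tab /ffunP dab].
apply: lt_le_trans mP; apply: (located_close infa infb lax lby tab) => k _.
have [Nk|kN] := leqP N k; first by rewrite (final_digit len infa) ?fa // (final_digit len infb) ?fb.
have := dab (Ordinal kN); rewrite !ffunE /= => /(congr1 val).
by rewrite /= !inordK // ltnS ltnW // (infinite_address_digit len).
Qed.

Lemma iiet_cluster_ae :
  {ae (@lebesgue_measure R), forall x : R, x \in `[0, 1] ->
    exists2 u : nat -> R,
      forall n, iter_partial F (K ^ n.+1)%N x = Some (u n) &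
      (cluster (u @ \oo) #<= `I_#|A|)%card}.
Proof.
have null X : countable X -> (@lebesgue_measure R).-negligible X.
  by move=> cX; exists X; split=> //;
    [exact: countable_measurable|exact: countable_lebesgue_measure0].
(* The point 1 belongs to no interval. *)
apply: negligibleS (negligibleU (null _ eventually_final_countable)
  (null _ (countable1 1))).
move=> x /= Hx; apply: contrapT => /not_orP[nx1 nx2]; apply: Hx.
rewrite in_itv /= => /andP[x0 x1].
have [|a infa lax] := @located_exists x.
  by rewrite x0 lt_neqAle x1 andbT; apply/eqP.
have nfa : infinitely_often_nonfinal a.
  move=> M; apply: contrapT => nM; apply: nx1; exists a; split=> //; exists M => k Mk.
  by apply/negP => nfk; apply: nM; exists k.
have /choice[bu buP] n : exists bu : (nat -> A * nat) * R,
    [/\ iter_partial F (K ^ n.+1) x = Some bu.2, infinite_address S bu.1,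
     located bu.1 bu.2 & forall k, (k < n.+1)%N -> (bu.1 k).2 = (a k).2].
  by have [b [y byP]] := iter_iiet_prefix n.+1 infa lax nfa; exists (b, y).
exists (fun n => (bu n).2); first by move=> n; have [] := buP n.
apply: (@cluster_card_le a (fun n => (bu n).1)) => //; try by move=> n; have [] := buP n.
by move=> n k kn; have [_ _ _ ->] := buP n; rewrite // ltnS ltnW.
Qed.
End Geometry.

Theorem proposition5p1 (R : realType) (A : finType) (S : substitution A)
    (K : nat) (F : R -> option R)
    (prim : primitive S) (recog : recognizable S) (len : constant_length S K)
    (canF : canonical_iiet S F) :
  {ae (@lebesgue_measure R), forall x : R, x \in `[0, 1] ->
    exists2 u : nat -> R,
      forall n, iter_partial F (K ^ n.+1)%N x = Some (u n) &
      (cluster (u @ \oo) #<= `I_#|A|)%card}.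
Proof.
case: canF => a0 [mu [lam [Phi0 [ordT [inv pf Phi0P ordTP ->]]]]].
have -> := perron_frobenius_constant_length len a0 pf.
apply: (iiet_cluster_ae len) => //.
- exact: letter_mass_ge0.
- exact: letter_mass_le1.
- by move=> c; have [uc Tc] := ordTP c; exact: letter_mass_incoming.
Qed.
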